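(* Let $\mathrm{a}_1,\mathrm{a}_2$ be positive integers such that $\mathrm{a}_1\le 7$ if $\mathrm{a}_2=1$, and $\mathrm{a}_1\le 3\,\mathrm{a}_2+3$ if $\mathrm{a}_2\ge2$. Then $f(z)=\mathrm{a}_2z^2+\mathrm{a}_1z+1$ is the $h^\star$-polynomial of a lattice polytope, i.e. there are a positive integer $d$ and a $d$-dimensional convex lattice polytope $P\subset\mathbb{R}^d$ whose $h^\star$-polynomial is $f$.
   Context: A $d$-dimensional convex lattice polytope is a convex polytope $P\subset\mathbb{R}^d$ with $\dim P=d$, all of whose vertices lie in $\mathbb{Z}^d$. The Ehrhart series of $P$ is $\mathrm{Ehr}_P(z)=\sum_{k\ge0}\#(kP\cap\mathbb{Z}^d)\,z^k$ (with constant term $1$). It can be written as $\mathrm{Ehr}_P(z)=\frac{h^\star(z)}{(1-z)^{d+1}}$ with a polynomial $h^\star(z)$ of degree at most $d$; this $h^\star$ is called the $h^\star$-polynomial of $P$. *)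

(* Defs.v *)
From HB Require Import structures.
From mathcomp Require Import all_boot all_order all_algebra finmap.
From mathcomp Require Import boolp classical_sets functions cardinality reals.

Set Implicit Arguments.
Unset Strict Implicit.
Unset Printing Implicit Defensive.

Import Order.TTheory GRing.Theory Num.Theory.

Local Open Scope classical_set_scope.
Local Open Scope ring_scope.

Section LatticePolytopes.
Variables (R : realType) (d : nat).
Implicit Types (A P : set 'rV[R]_d).

Definition convex_hull A : set 'rV[R]_d :=
  [set x | exists (n : nat) (v : 'I_n -> 'rV[R]_d) (w : 'I_n -> R),
     [/\ forall i, A (v i), forall i, 0 <= w i, \sum_i w i = 1
       & x = \sum_i w i *: v i]].

Definition affine_hull A : set 'rV[R]_d :=
  [set x | exists (n : nat) (v : 'I_n -> 'rV[R]_d) (w : 'I_n -> R),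
     [/\ forall i, A (v i), \sum_i w i = 1 & x = \sum_i w i *: v i]].

Definition is_polytope P : Prop :=
  exists2 V : set 'rV[R]_d, finite_set V & P = convex_hull V.

(* The dimension of P is the dimension of the affine subspace p + U it spans;
   the empty set has no dimension in this sense. *)
Definition has_dim P (k : nat) : Prop :=
  exists (p : 'rV[R]_d) (U : {vspace 'rV[R]_d}),
    affine_hull P = [set p + u | u in [set u | u \in U]] /\ (\dim U)%VS = k.

(* For a polytope, the vertices are exactly the extreme points. *)
Definition is_vertex P (x : 'rV[R]_d) : Prop :=
  P x /\ forall (y z : 'rV[R]_d) (t : R), P y -> P z -> 0 < t < 1 ->
    x = t *: y + (1 - t) *: z -> y = x /\ z = x.

Definition integer_lattice : set 'rV[R]_d := [set x | x \is a mxOver Num.int].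

Definition is_lattice_polytope P : Prop :=
  is_polytope P /\ is_vertex P `<=` integer_lattice.

Definition dilate (k : nat) P : set 'rV[R]_d := [set k%:R *: x | x in P].

(* A formal power series is represented by its sequence of coefficients.
   The cardinality below is a genuine one for bounded P, in particular for
   polytopes ([fset_set] would send an infinite set to the empty one). *)
Definition ehrhart_series P : nat -> int :=
  fun k => (#|` fset_set (dilate k P `&` integer_lattice)|)%:Z.

(* h = (1 - z)^(d + 1) * Ehr_P(z) as formal power series; this is meant for P
   of full dimension d. *)
Definition is_hstar_polynomial P (h : {poly int}) : Prop :=
  (size h <= d.+1)%N /\
  forall n : nat,
    h`_n = \sum_(i < n.+1) ((1 - 'X) ^+ d.+1 : {poly int})`_i
                           * ehrhart_series P (n - i)%N.

End LatticePolytopes.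

(* Main.v *)
Require Import Defs.
From HB Require Import structures.
From mathcomp Require Import all_boot all_order all_algebra finmap.
From mathcomp Require Import boolp classical_sets functions cardinality reals.
From mathcomp Require Import ring lra zify.

Set Implicit Arguments.
Unset Strict Implicit.
Unset Printing Implicit Defensive.

Import Order.TTheory GRing.Theory Num.Theory.

Local Open Scope classical_set_scope.
Local Open Scope ring_scope.

Definition delta (E : nat -> int) (n : nat) : int :=
  E n - (if n is n'.+1 then E n' else 0).
(** The polynomial is realised by explicit polytopes, of dimension 2 when
    a2 < a1 and of dimension 3 when a1 <= a2.

    If a polytope P of dimension d has the lattice point counts
    C(k+d,d) + a1 C(k+d-1,d) + a2 C(k+d-2,d) in its dilates k P, then
    1 + a1 z + a2 z^2 is its h*-polynomial, because
    sum_k C(k+d-j,d) z^k = z^j / (1-z)^(d+1) for j <= d: multiplying by 1 - z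
    is taking the backward difference of the coefficients, which lowers d by
    Pascal's rule ([hstar_criterion], [hstar_degree2]).

    Every polytope used below consists of segments over a lattice polytope B:
    its points are the (b, z) with b in B and low(b) <= z <= high(b), where low
    and high are affine on each simplex of a unimodular triangulation of B.
    Hence in every dilate the segment over a lattice point has integral ends,
    and the lattice points are counted by summing the integers
    high - low + 1 over the lattice points of k B, without any rounding.

    - Over B = [0, e+1], take low = 0 and high with values p, s e, 0 at
      0, 1, e+1 ([quad_polytope]). Concavity of high is p <= s (e+1), and the
      count gives a1 = p + s C(e+1,2) + e - 1, a2 = s C(e+1,2) - e. With e = 1
      these are all pairs with a2 < a1 <= 3 a2 + 3, and e = 2, s = 1, p = 3 is
      the triangle 3 Delta_2, whose h*-polynomial 1 + 7 z + z^2 is the only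
      remaining case.
    - Over B = [0,1]^2, take a segment of length a over (0,0), the points at
      height 0 over (1,0) and (0,1), and the point at height r over (1,1)
      ([tent_polytope]): a Reeve tetrahedron with vertices (0,0,a), (1,0,0),
      (0,1,0), (1,1,r), of normalised volume a + r, and glued to one of its
      facets the tetrahedron with apex (0,0,0), of normalised volume a. There
      are a + 4 lattice points, so a1 = a, and 1 + a1 + a2 is the volume
      2 a + r. Thus a2 = a + r - 1, and a >= 1, r >= 1 give all pairs with
      a1 <= a2. *)

(** * Convex hulls of finite lattice sets *)

Section Hulls.
Variables (R : realType) (d : nat).
Implicit Types (vs : seq 'rV[R]_d) (x : 'rV[R]_d) (t : R).

(** The weights add up to t instead of 1, so that with t = k this describes the
    k-th dilate, uniformly for k = 0. The family of weights is indexed by all of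
    [nat] to let it be given by a literal list. *)
Definition scaled_comb vs t x : Prop :=
  exists w : nat -> R,
    [/\ forall i, 0 <= w i, \sum_(i < size vs) w i = t
      & x = \sum_(i < size vs) w i *: vs`_i].

Lemma scaled_comb_convex vs t l x y :
  0 <= l <= 1 -> scaled_comb vs t x -> scaled_comb vs t y ->
  scaled_comb vs t (l *: x + (1 - l) *: y).
Proof.
move=> /andP[l0 l1] [w [w0 sw ->]] [u [u0 su ->]].
exists (fun i => l * w i + (1 - l) * u i); split=> [i||].
- by rewrite addr_ge0 // mulr_ge0 // subr_ge0.
- by rewrite big_split /= -!mulr_sumr sw su; ring.
- rewrite !scaler_sumr -big_split /=; apply: eq_bigr => i _.
  by rewrite !scalerA scalerDl.
Qed.

(** Turning arbitrary convex combinations into one weight per listed point, so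
    that linear inequalities on a dilate can be read off the weights. *)
Lemma dilate_hullP vs k x : vs != [::] ->
  dilate k (convex_hull [set` vs]) x <-> scaled_comb vs k%:R x.
Proof.
move=> vs_neq0; have vs_gt0 : (0 < size vs)%N by rewrite lt0n size_eq0.
split.
  move=> [_ [n [v [u [v_vs u0 su ->]]]]] <-.
  have ltv i : (index (v i) vs < size vs)%N by rewrite index_mem; apply: v_vs.
  pose f i := Ordinal (ltv i).
  exists (fun j => k%:R * \sum_(i | f i == j :> nat) u i); split=> [j||].
  - by rewrite mulr_ge0 // sumr_ge0.
  - by rewrite -mulr_sumr -[RHS]mulr1 -su (partition_big f xpredT).
  - rewrite (partition_big f xpredT) //= scaler_sumr; apply: eq_bigr => j _.
    rewrite -scalerA; congr (_ *: _); rewrite scaler_suml.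
    apply: eq_bigr => i /eqP <-; rewrite nth_index //; exact: v_vs.
move=> [w [w0 sw ->]].
have vs_nth (i : 'I_(size vs)) : [set` vs] vs`_i by apply/mem_nth.
(* For k = 0 the weights vanish, and the dilate is {0} since the hull is
   not empty. *)
have [k0|k_neq0] := eqVneq (k%:R : R) 0.
  have w_eq0 (i : 'I_(size vs)) : w i = 0.
    by apply: (psumr_eq0P _ (etrans sw k0)).
  rewrite big1 => [|i _]; last by rewrite w_eq0 scale0r.
  exists vs`_0; last by rewrite k0 scale0r.
  exists 1%N, (fun=> vs`_0), (fun=> 1); split=> // [i||].
  - exact: (vs_nth (Ordinal vs_gt0)).
  - by rewrite big_ord1.
  - by rewrite big_ord1 scale1r.
exists (\sum_(i < size vs) (w i / k%:R) *: vs`_i); last first.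
  rewrite scaler_sumr; apply: eq_bigr => i _.
  by rewrite scalerA mulrCA divff // mulr1.
exists (size vs), (fun i => vs`_i), (fun i : 'I_(size vs) => w i / k%:R).
split=> // [i|]; first by rewrite divr_ge0.
by rewrite -mulr_suml sw divff.
Qed.

Lemma sub_convex_hull (A : set 'rV[R]_d) : A `<=` convex_hull A.
Proof.
move=> v Av; exists 1%N, (fun=> v), (fun=> 1).
by split; rewrite ?big_ord1 ?scale1r.
Qed.

(** The extreme points of the hull are among the listed lattice points: any point
    of the hull divides a segment from a listed point v i of positive weight to
    a point of the hull, and extremality makes it equal to v i. *)
Lemma is_lattice_polytope_hull vs :
  {in vs, forall v, v \is a mxOver Num.int} ->
  is_lattice_polytope (convex_hull [set` vs]).
Proof.
move=> vs_int; split; first by exists [set` vs].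
move=> _ [[n [v [w [v_vs w0 sw ->]]]] x_ext].
have [i /andP[_ wi_gt0]] : exists i, true && (0 < w i).
  by apply/psumr_neq0P => //; rewrite sw; apply/eqP/oner_neq0.
have wi_le1 : w i <= 1 by rewrite -sw (bigD1 i) //= lerDl sumr_ge0.
(* Only half of the weight of v i is split off: then 1 - t never vanishes,
   even when the whole weight sits on v i. *)
pose t := w i / 2.
have t01 : 0 < t < 1 by rewrite /t; lra.
have t1_neq0 : 1 - t != 0 by lra.
pose u j := (w j - (j == i)%:R * t) / (1 - t).
have sum_it (F : 'I_n -> 'rV[R]_d) : \sum_j ((j == i)%:R * t) *: F j = t *: F i.
  rewrite (bigD1 i) //= eqxx mul1r big1 ?addr0 // => j /negPf ->.
  by rewrite mul0r scale0r.
have sum_it1 : \sum_j (j == i)%:R * t = t.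
  by rewrite (bigD1 i) //= eqxx mul1r big1 ?addr0 // => j /negPf ->; rewrite mul0r.
have hull_v : convex_hull [set` vs] (v i) by apply: sub_convex_hull (v_vs i).
have hull_z : convex_hull [set` vs] (\sum_j u j *: v j).
  exists n, v, u; split=> // [j|].
    rewrite /u divr_ge0 //; last by lra.
    case: eqP => [->|_]; last by rewrite mul0r subr0.
    by rewrite mul1r /t; lra.
  by rewrite -mulr_suml sumrB sw sum_it1 divff.
have [|<- _] := x_ext _ _ _ hull_v hull_z t01; last exact: vs_int (v_vs i).
rewrite scaler_sumr -(sum_it v) -big_split; apply: eq_bigr => j _ /=.
by rewrite scalerA -scalerDl [(1 - t) * _]mulrC divfK // addrC subrK.
Qed.

Lemma has_dim_full (P : set 'rV[R]_d) (M : 'M[R]_d) :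
  \det M != 0 -> P 0 -> (forall i, P (row i M)) -> has_dim P d.
Proof.
move=> detM P0 PM; exists 0, fullv; split; last by rewrite dimvf /dim /= mul1n.
apply/seteqP; split=> [x _|_ [x _ <-]]; first by exists x; rewrite ?add0r //= memvf.
have M_unit : M \in unitmx by rewrite unitmxE unitfE.
pose c := x *m invmx M.
(* Coordinates in the basis of rows, with the missing weight put on 0. *)
exists d.+1,
  (fun i => if unlift ord0 i is Some j then row j M else 0),
  (fun i => if unlift ord0 i is Some j then c 0 j else 1 - \sum_j c 0 j).
split=> [i||].
- by case: unlift.
- rewrite big_ord_recl unlift_none.
  under [X in _ + X]eq_bigr do rewrite liftK.
  by rewrite subrK.
- rewrite big_ord_recl unlift_none scaler0 !add0r.
  under eq_bigr do rewrite liftK.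
  by rewrite -mulmx_sum_row mulmxKV.
Qed.

Lemma ehrhart_series_size (P : set 'rV[R]_d) k (s : seq 'rV[R]_d) :
  uniq s -> dilate k P `&` @integer_lattice R d = [set` s] ->
  ehrhart_series P k = size s.
Proof.
move=> s_uniq Ps; rewrite /ehrhart_series Ps.
have -> : [set` s] = [set` [fset x in s]%fset].
  by apply/seteqP; split=> x /=; rewrite !inE.
by rewrite set_fsetK card_fseq undup_id.
Qed.

End Hulls.

(** * From lattice point counts to the h*-polynomial *)

Definition backward_diff (E : nat -> int) (n : nat) : int :=
  E n - (if n is n'.+1 then E n' else 0).

(** Multiplying a power series by 1 - z replaces its coefficients by their
    backward differences; here the factor is moved from one side of a Cauchy
    product to the other. *)
Lemma conv_backward_diff (q : {poly int}) (E : nat -> int) (n : nat) :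
  \sum_(i < n.+1) ((1 - 'X) * q)`_i * E (n - i)%N
  = \sum_(i < n.+1) q`_i * backward_diff E (n - i)%N.
Proof.
have -> : (1 - 'X) * q = q - 'X * q by rewrite mulrBl mul1r.
under eq_bigr do rewrite coefB coefXM mulrBl.
under [RHS]eq_bigr do rewrite /backward_diff mulrBr.
rewrite !sumrB; congr (_ - _).
rewrite big_ord_recl /= mul0r add0r [RHS]big_ord_recr /= subnn mulr0 addr0.
apply: eq_bigr => i _; rewrite /bump /= add1n /= subnS.
by have := subn_gt0 i n; rewrite ltn_ord; case: (n - i)%N.
Qed.

Lemma conv_exp_backward_diff (m : nat) (E : nat -> int) (n : nat) :
  \sum_(i < n.+1) ((1 - 'X) ^+ m : {poly int})`_i * E (n - i)%N
  = iter m backward_diff E n.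
Proof.
elim: m E => [|m IHm] E; last by rewrite exprS conv_backward_diff IHm -iterSr.
rewrite big_ord_recl /= expr0 coef1 mul1r subn0 big1 ?addr0 // => i _.
by rewrite coef1 mul0r.
Qed.

(** The expansion of the Ehrhart series in the basis z^j / (1-z)^(d+1): the
    (d+1)-fold backward difference undoes the iterated summation that the
    binomial coefficients stand for. *)
Lemma hstar_criterion (R : realType) (d : nat) (P : set 'rV[R]_d)
    (h : {poly int}) :
  (size h <= d.+1)%N ->
  (forall n, ehrhart_series P n
             = \sum_(j < n.+1) h`_j * 'C(n - j + d, d)%:Z) ->
  is_hstar_polynomial P h.
Proof.
move=> size_h EP; split=> // n; rewrite conv_exp_backward_diff.
pose B m n := \sum_(j < n.+1) h`_j * 'C(n - j + m, m)%:Z.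
(* Pascal's rule; the summand j = k.+1, absent at the previous index,
   contributes 'C(m.+1, m.+1) = 'C(m, m). *)
have diffB m : backward_diff (B m.+1) = B m.
  apply/funext => -[|k]; rewrite /backward_diff /B.
    by rewrite !big_ord_recr !big_ord0 /= subr0 !add0n !binn.
  rewrite big_ord_recr [RHS]big_ord_recr /= subnn !add0n !binn addrAC.
  congr (_ + _); rewrite -sumrB; apply: eq_bigr => j _.
  have -> : 'C(k.+1 - j + m.+1, m.+1)
            = ('C(k - j + m.+1, m.+1) + 'C(k.+1 - j + m, m))%N.
    have j_le_k : (j <= k)%N by rewrite -ltnS.
    by rewrite (subSn j_le_k) addSn binS addSnnS.
  by rewrite -mulrBr PoszD [X in X - _]addrC addrK.
have -> : ehrhart_series P = B d by apply/funext => k; rewrite EP.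
rewrite iterS.
have -> : iter d backward_diff (B d) = B 0%N.
  by elim: d {size_h EP P} => // m IHm; rewrite iterSr diffB.
case: n => [|n]; rewrite /backward_diff /B.
  by rewrite big_ord_recr big_ord0 /= add0r bin0 mulr1 subr0.
rewrite big_ord_recr /= bin0 mulr1.
under eq_bigr do rewrite bin0.
under [X in _ - X]eq_bigr do rewrite bin0.
by rewrite addrAC subrr add0r.
Qed.

Lemma hstar_degree2 (R : realType) (d : nat) (P : set 'rV[R]_d) (a1 a2 : nat) :
  (1 < d)%N ->
  (forall n, ehrhart_series P n
     = ('C(n + d, d) + a1 * 'C((n + d).-1, d) + a2 * 'C((n + d).-2, d))%N) ->
  is_hstar_polynomial P (a2%:Z *: 'X^2 + a1%:Z *: 'X + 1).
Proof.
move=> d_gt1 EP; set h := (X in is_hstar_polynomial _ X).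
have coefh j : h`_j = nth 0 [:: 1; a1%:Z; a2%:Z] j.
  rewrite /h !coefD !coefZ coefXn coefX coef1.
  by case: j => [|[|[|j]]] /=; rewrite ?nth_nil; ring.
apply: hstar_criterion => [|n].
  apply/leq_sizeP => j dj; rewrite coefh nth_default //=.
  exact: leq_trans dj.
rewrite {}EP !PoszD !PoszM; case: n => [|[|n]].
- rewrite big_ord_recl big_ord0 coefh /= subn0.
  rewrite (@bin_small d.-1) ?(@bin_small d.-2); [|lia|lia].
  by rewrite !mulr0 !addr0.
- rewrite 2!big_ord_recl big_ord0 !coefh /= subn0 subnn !add0n.
  rewrite (@bin_small d.-1) ?mulr0 ?addr0; last lia.
  by rewrite mul1r.
rewrite 3!big_ord_recl big1 => [|i _]; last first.
  by rewrite coefh nth_default ?mul0r.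
by rewrite !coefh /= addr0 addrA mul1r !subSS !subn0.
Qed.

(** * Sums of column heights *)

Section LatticeCounts.
Local Open Scope nat_scope.

Lemma double_bin2 n : 'C(n, 2) * 2 + n = n * n.
Proof. by elim: n => // n IHn; rewrite binS bin1; lia. Qed.

(** The degree 2 polynomial C(ek+1, 2) in k, expanded in the binomials in which
    the h*-coefficients of a polygon are read off. *)
Lemma bin2_mul e k :
  'C((e * k).+1, 2) = 'C(e.+1, 2) * 'C(k.+1, 2) + 'C(e, 2) * 'C(k, 2).
Proof.
rewrite !binS !bin1.
have := double_bin2 (e * k); have := double_bin2 e; have := double_bin2 k.
move: 'C(k, 2) 'C(e, 2) 'C(e * k, 2) => c f g ck fe gek.
suff : (g * 2 + e * k + e * k) * 2
       = (f * 2 + e + e) * (c * 2 + k + k) + f * 2 * (c * 2) by lia.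
rewrite ck fe gek; nia.
Qed.

Lemma sum_ord_id n : \sum_(i < n) i = 'C(n, 2).
Proof. by rewrite -bin2_sum big_mkord. Qed.

(** The height, over y in [0, (e+1)k], of the k-th dilate of the quadrilateral
    with vertices (0,0), (0,p), (1,se), (e+1,0). *)
Definition quad_height (p s e k y : nat) : nat :=
  if y <= k then p * (k - y) + s * e * y else s * (e.+1 * k - y).

Lemma sum_quad_height p s e k :
  0 < e ->
  \sum_(y < (e.+1 * k).+1) (quad_height p s e k y).+1 + e * 'C(k, 2)
  = 'C(k.+2, 2) + (p + s * 'C(e.+1, 2) + e.-1) * 'C(k.+1, 2)
    + s * 'C(e.+1, 2) * 'C(k, 2).
Proof.
move=> e_gt0.
have low : \sum_(y < k) (quad_height p s e k y).+1
           = p * 'C(k.+1, 2) + s * e * 'C(k, 2) + k.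
  transitivity (\sum_(y < k) (p * (k - y) + s * e * y + 1)).
    by apply: eq_bigr => y _; rewrite /quad_height (ltnW (ltn_ord y)) addn1.
  rewrite !big_split /= -!big_distrr /= sum_ord_id sum_nat_const card_ord muln1.
  congr (p * _ + _ + _); rewrite (reindex_inj rev_ord_inj) /= -sum_ord_id.
  rewrite big_ord_recl add0n; apply: eq_bigr => i _.
  by rewrite subKn // ltnW.
have high : \sum_(k <= y < (e.+1 * k).+1) (quad_height p s e k y).+1
           = s * 'C((e * k).+1, 2) + (e * k).+1.
  rewrite -{1}(add0n k) big_addn mulSn -addnS addKn big_mkord.
  transitivity (\sum_(i < (e * k).+1) (s * (e * k - i) + 1)).
    apply: eq_bigr => i _; rewrite /quad_height addn1; congr _.+1.
    case: leqP => [ik|_]; last by rewrite mulSn addnC subnDr.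
    have -> : i = 0 :> nat by lia.
    by rewrite add0n subnn muln0 add0n subn0 mulnA.
  rewrite big_split /= -big_distrr /= sum_nat_const card_ord muln1.
  congr (s * _ + _); rewrite (reindex_inj rev_ord_inj) /= -sum_ord_id.
  by apply: eq_bigr => i _; rewrite subSS subKn // -ltnS.
rewrite -(big_mkord xpredT (fun y => (quad_height p s e k y).+1)).
rewrite (@big_cat_nat _ _ _ k) //=; last by rewrite leqW // leq_pmull.
rewrite big_mkord low high bin2_mul.
rewrite !binS !bin1 !bin0; move: 'C(k, 2) 'C(e, 2) => c f.
case: e e_gt0 {low high} => // e _; rewrite -pred_Sn.
lia.
Qed.

Lemma square_bin3 k : k.+1 ^ 2 + 'C(k.+1, 3) = 'C(k.+3, 3).
Proof.
have := double_bin2 k.+1; rewrite -mulnn (binS k.+2) (binS k.+1 2).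
rewrite (binS k.+1 1) bin1; lia.
Qed.

(** A sum of squares: dropping the row and the column of zeros shifts both
    indices by 1, which raises minn by 1 at (k+1)^2 places. *)
Lemma sum_minn k :
  \sum_(x < k.+1) \sum_(y < k.+1) minn x y = 'C(k.+2, 3) + 'C(k.+1, 3).
Proof.
elim: k => [|k IHk]; first by rewrite !big_ord_recl !big_ord0.
rewrite big_ord_recl [X in X + _]big1 ?add0n => [|y _]; last by rewrite min0n.
transitivity (\sum_(x < k.+1) \sum_(y < k.+1) (minn x y + 1)).
  apply: eq_bigr => x _; rewrite big_ord_recl minn0 add0n.
  by apply: eq_bigr => y _; rewrite /= /bump !add1n minnSS addn1.
under eq_bigr => x _ do rewrite big_split /= sum_nat_const card_ord muln1.
rewrite big_split /= IHk sum_nat_const card_ord -square_bin3; lia.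
Qed.

Lemma sum_subn_maxn k :
  \sum_(x < k.+1) \sum_(y < k.+1) (k - maxn x y) = 'C(k.+2, 3) + 'C(k.+1, 3).
Proof.
(* The central symmetry of the square exchanges k - maxn and minn. *)
rewrite -sum_minn (reindex_inj rev_ord_inj); apply: eq_bigr => x _ /=.
rewrite (reindex_inj rev_ord_inj); apply: eq_bigr => y _ /=.
have := ltn_ord x; have := ltn_ord y; lia.
Qed.

Lemma sum_excess k :
  \sum_(x < k.+1) \sum_(y < k.+1) (x + y - k) = 'C(k.+2, 3).
Proof.
elim: k => [|k IHk]; first by rewrite !big_ord_recl !big_ord0.
rewrite big_ord_recl [X in X + _]big1 ?add0n => [|y _]; last first.
  by have := ltn_ord y => /=; lia.
transitivity (\sum_(x < k.+1) (\sum_(y < k.+1) (x + y - k) + x.+1)).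
  apply: eq_bigr => x _; rewrite big_ord_recr /=; congr (_ + _).
  by rewrite /bump; lia.
rewrite big_split /= IHk (binS k.+2); congr (_ + _).
by rewrite -sum_ord_id [RHS]big_ord_recl add0n.
Qed.

(** The ends of the vertical segment over the lattice point q of [0,k]^2 in the
    k-th dilate of the hull of (0,0,0), (0,0,a), (1,0,0), (0,1,0), (1,1,r). The
    lower hull folds the square along the antidiagonal, which truncated
    subtraction expresses, and the upper hull along the diagonal. *)
Definition tent_low (r k : nat) (q : nat * nat) : nat := r * (q.1 + q.2 - k).

Definition tent_high (a r k : nat) (q : nat * nat) : nat :=
  a * (k - maxn q.1 q.2) + r * minn q.1 q.2.

Lemma sum_tent a r k :
  \sum_(x < k.+1) \sum_(y < k.+1)
      (tent_high a r k (x : nat, y : nat) - tent_low r k (x : nat, y : nat)).+1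
    + 'C(k.+1, 3)
  = 'C(k.+3, 3) + a * 'C(k.+2, 3) + (a + r) * 'C(k.+1, 3).
Proof.
pose F x y := (tent_high a r k (x, y) - tent_low r k (x, y)).+1.
(* The truncated difference is split by moving the lower ends to the left. *)
have F_low : \sum_(x < k.+1) \sum_(y < k.+1) F x y + r * 'C(k.+2, 3)
    = a * ('C(k.+2, 3) + 'C(k.+1, 3)) + r * ('C(k.+2, 3) + 'C(k.+1, 3))
      + k.+1 * k.+1.
  rewrite -{1}sum_subn_maxn -sum_minn -sum_excess.
  rewrite !big_distrr -big_split /= -[X in _ + X * _]card_ord -sum_nat_const.
  rewrite -!big_split; apply: eq_bigr => x _ /=.
  rewrite !big_distrr -!big_split /= -[X in _ + X]muln1.
  rewrite -[X in _ + X * _]card_ord -sum_nat_const -!big_split.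
  apply: eq_bigr => y _ /=; rewrite /F /tent_high /tent_low /=.
  have low_le : r * (x + y - k) <= r * minn x y.
    by rewrite leq_mul2l; have := ltn_ord x; have := ltn_ord y; lia.
  by rewrite addSn subnK ?addn1 // (leq_trans low_le) // leq_addl.
rewrite -square_bin3 -mulnn -[X in X + _]/(\sum_(x < k.+1) \sum_(y < k.+1) F x y).
by move: F_low; lia.
Qed.

End LatticeCounts.

(** * Points given by coordinates *)

Section Coordinates.
Variables (R : realType) (d : nat).

Definition vec (s : seq R) : 'rV[R]_d := \row_j s`_j.

Lemma vec_lattice (s : seq nat) :
  @integer_lattice R d (vec [seq n%:R | n <- s]).
Proof.
apply/mxOverP => i j; rewrite mxE.
have [j_lt|j_ge] := ltnP j (size s); last by rewrite nth_default ?size_map ?rpred0.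
by rewrite (nth_map 0%N) // rpred_nat.
Qed.

(** By convexity it suffices to reach the two ends of each vertical segment. *)
Lemma scaled_comb_between (vs : seq 'rV[R]_d) t (b : seq R) (lo z hi : R) :
  lo <= z <= hi ->
  scaled_comb vs t (vec (rcons b lo)) -> scaled_comb vs t (vec (rcons b hi)) ->
  scaled_comb vs t (vec (rcons b z)).
Proof.
move=> /andP[lo_z z_hi] comb_lo comb_hi.
have [lohi|lohi] := eqVneq lo hi.
  by have -> : z = lo by lra.
have lt_lohi : lo < hi by rewrite lt_neqAle lohi (le_trans lo_z).
pose l := (z - lo) / (hi - lo).
have l01 : 0 <= l <= 1.
  apply/andP; split; first by rewrite divr_ge0 ?subr_ge0 // ltW.
  by rewrite ler_pdivrMr ?subr_gt0 // mul1r lerD2r.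
have -> : vec (rcons b z) = l *: vec (rcons b hi) + (1 - l) *: vec (rcons b lo).
  apply/rowP => j; rewrite !mxE !nth_rcons.
  case: ifP => _; first by ring.
  case: ifP => _; last by ring.
  by rewrite /l; field; rewrite subr_eq0 eq_sym.
exact: scaled_comb_convex.
Qed.

End Coordinates.

Arguments vec {R} d s.

(** * The planar quadrilaterals *)

Section Quadrilateral.
Variables (R : realType) (p s e : nat).
Hypotheses (e_gt0 : (0 < e)%N) (p_le : (p <= s * e.+1)%N).

Definition quad_vertices : seq 'rV[R]_2 :=
  [:: vec 2 [:: 0; 0]; vec 2 [:: 0; p%:R]; vec 2 [:: 1; (s * e)%:R];
      vec 2 [:: e.+1%:R; 0]].

Definition quad_points k : seq 'rV[R]_2 :=
  [seq vec 2 [:: y%:R; h%:R] | y <- iota 0 (e.+1 * k).+1,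
                               h <- iota 0 (quad_height p s e k y).+1].

(** The condition p <= s (e+1) says that (1,se) is not below the segment from
    (0,p) to (e+1,0): with it, both linear bounds of [quad_height] hold on the
    whole hull. *)
Lemma quad_pointsP k :
  dilate k (convex_hull [set` quad_vertices]) `&` @integer_lattice R 2
  = [set` quad_points k].
Proof.
have e0 : (0 : R) < e%:R by rewrite ltr0n.
have p_leR : (p%:R : R) <= s%:R * (1 + e%:R) by rewrite nat1r -natrM ler_nat.
apply/seteqP; split=> x /=.
  move=> [/dilate_hullP -/(_ isT) [w [w0 sw xw]] x_int].
  have p_gap : (0 : R) <= s%:R * (1 + e%:R) - p%:R by rewrite subr_ge0.
  have e1_ge0 : (0 : R) <= 1 + e%:R by rewrite addr_ge0 ?ler0n.
  have x0 : x ord0 ord0 = w 2 + e.+1%:R * w 3.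
    by rewrite xw summxE !big_ord_recl big_ord0 !mxE /=; ring.
  have x1 : x ord0 (lift ord0 ord0) = p%:R * w 1 + (s * e)%:R * w 2.
    by rewrite xw summxE !big_ord_recl big_ord0 !mxE /=; ring.
  move: sw (w0 0) (w0 1) (w0 2) (w0 3); rewrite !big_ord_recl big_ord0 /= !addr0.
  move=> {xw} + w0_ge0 w1_ge0 w2_ge0 w3_ge0.
  rewrite -/(w 0%N + (w 1%N + (w 2%N + w 3%N)) = _) => sw.
  have /natrP[y yE] : x ord0 ord0 \is a Num.nat.
    by rewrite natrEint (mxOverP x_int) x0 addr_ge0 ?mulr_ge0 ?ler0n.
  have /natrP[h hE] : x ord0 (lift ord0 ord0) \is a Num.nat.
    by rewrite natrEint (mxOverP x_int) x1 addr_ge0 ?mulr_ge0 ?ler0n.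
  rewrite yE in x0; rewrite hE in x1.
  have y_le : (y <= e.+1 * k)%N.
    rewrite -(ler_nat R) natrM -sw x0 -nat1r; nra.
  apply/allpairsPdep; exists y, h; rewrite !mem_iota !add0n /= !ltnS; split=> //.
    rewrite /quad_height; case: (leqP y k) => yk.
      rewrite -(ler_nat R) natrD !natrM (natrB _ yk) x0 x1 -sw -nat1r natrM.
      (* The gap to this edge is p w0 + e (s (e+1) - p) w3. *)
      have := mulr_ge0 (ler0n R p) w0_ge0.
      have := mulr_ge0 (mulr_ge0 (ltW e0) w3_ge0) p_gap.
      lra.
    rewrite -(ler_nat R) natrM (natrB _ y_le) !natrM x0 x1 -sw -nat1r natrM.
    (* The gap to this edge is s (e+1) w0 + (s (e+1) - p) w1. *)
    have := mulr_ge0 (mulr_ge0 (ler0n R s) e1_ge0) w0_ge0.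
    have := mulr_ge0 p_gap w1_ge0.
    lra.
  apply/rowP => -[[|[|//]] i]; rewrite mxE /=.
    by rewrite -yE; congr (x _ _); apply: val_inj.
  by rewrite -hE; congr (x _ _); apply: val_inj.
move=> /allpairsPdep[y [h [+ + ->]]]; rewrite !mem_iota !add0n /= => y_lt h_lt.
split; last exact: (@vec_lattice R 2 [:: y; h]).
have y_le : (y%:R : R) <= (1 + e%:R) * k%:R by rewrite nat1r -natrM ler_nat.
have e_neq0 : (e%:R : R) != 0 by rewrite lt0r_neq0.
have e1_neq0 : (1 + e%:R : R) != 0 by rewrite nat1r pnatr_eq0.
apply/dilate_hullP => //.
apply: (@scaled_comb_between _ _ _ _ [:: y%:R] 0 _ (quad_height p s e k y)%:R).
- by rewrite ler0n ler_nat -ltnS.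
(* (y, 0) lies on the edge from (0,0) to (e+1,0). *)
- exists (nth 0 [:: k%:R - y%:R / e.+1%:R; 0; 0; y%:R / e.+1%:R]).
  split=> [[|[|[|[|i]]]] //=||].
  + by rewrite subr_ge0 ler_pdivrMr ?ltr0n // mulrC -nat1r.
  + by rewrite divr_ge0.
  + by rewrite nth_nil.
  + by rewrite !big_ord_recl big_ord0 /=; ring.
  + apply/rowP => j; rewrite summxE !big_ord_recl big_ord0 !mxE.
    by case: j => [[|[|//]] i] /=; rewrite -?nat1r; field.
rewrite /quad_height; case: (leqP y k) => yk.
  (* Here the top edge joins (0,p) and (1,se), beyond it (1,se) and (e+1,0). *)
  exists (nth 0 [:: 0; k%:R - y%:R; y%:R; 0]); split=> [[|[|[|[|i]]]] //=||].
  + by rewrite subr_ge0 ler_nat.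
  + by rewrite nth_nil.
  + by rewrite !big_ord_recl big_ord0 /=; ring.
  + apply/rowP => j; rewrite summxE !big_ord_recl big_ord0 !mxE.
    case: j => [[|[|//]] i] /=; first by ring.
    by rewrite natrD !natrM natrB //; ring.
exists (nth 0 [:: 0; 0; ((1 + e%:R) * k%:R - y%:R) / e%:R; (y%:R - k%:R) / e%:R]).
split=> [[|[|[|[|i]]]] //=||].
+ by rewrite divr_ge0 ?subr_ge0 // ltW.
+ by rewrite divr_ge0 ?subr_ge0 ?ler_nat 1?ltnW // ltW.
+ by rewrite nth_nil.
+ by rewrite !big_ord_recl big_ord0 /=; field.
+ apply/rowP => j; rewrite summxE !big_ord_recl big_ord0 !mxE.
  case: j => [[|[|//]] i] /=; first by rewrite -nat1r; field.
  rewrite natrM natrB ?natrM; last by rewrite -ltnS.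
  by rewrite -nat1r; field.
Qed.

Lemma uniq_quad_points k : uniq (quad_points k).
Proof.
apply: allpairs_uniq_dep => [|y _|[y h] [y' h'] _ _ /=]; rewrite ?iota_uniq //.
move=> /rowP eq_yh; congr existT; apply/eqP; rewrite -(eqr_nat R); apply/eqP.
  by have := eq_yh ord0; rewrite !mxE.
by have := eq_yh (lift ord0 ord0); rewrite !mxE.
Qed.

Lemma ehrhart_quad k :
  ehrhart_series (convex_hull [set` quad_vertices]) k
  = (\sum_(y < (e.+1 * k).+1) (quad_height p s e k y).+1)%N.
Proof.
rewrite (ehrhart_series_size (uniq_quad_points k) (quad_pointsP k)).
rewrite size_allpairs_dep sumnE big_map; congr Posz.
rewrite -(subn0 (_ * k).+1) -/(index_iota _ _) big_mkord subn0.
by apply: eq_bigr => y _; rewrite size_iota.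
Qed.

Lemma quad_polytope (a1 a2 : nat) :
  (a1 = p + s * 'C(e.+1, 2) + e.-1)%N -> (a2 + e = s * 'C(e.+1, 2))%N ->
  (0 < s)%N ->
  [/\ is_lattice_polytope (convex_hull [set` quad_vertices]),
      has_dim (convex_hull [set` quad_vertices]) 2
    & is_hstar_polynomial (convex_hull [set` quad_vertices])
        (a2%:Z *: 'X^2 + a1%:Z *: 'X + 1)].
Proof.
move=> a1E a2E s_gt0; split.
- apply: is_lattice_polytope_hull => v; rewrite !inE.
  by move=> /or4P[]/eqP->;
    [exact: (@vec_lattice R 2 [:: 0; 0]%N)|exact: (@vec_lattice R 2 [:: 0; p]%N)
    |exact: (@vec_lattice R 2 [:: 1; s * e]%N)
    |exact: (@vec_lattice R 2 [:: e.+1; 0]%N)].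
- pose M : 'M[R]_2 := \matrix_(i, j)
    (nth [::] [:: [:: e.+1%:R; 0]; [:: 1; (s * e)%:R]] i)`_j.
  have PM v : v \in quad_vertices -> convex_hull [set` quad_vertices] v.
    exact: sub_convex_hull.
  apply: (@has_dim_full _ _ _ M).
  + rewrite det_trig; last first.
      by apply/is_trig_mxP => -[[|[|//]] i] [[|[|//]] j] //; rewrite mxE.
    rewrite !big_ord_recl big_ord0 !mxE /= mulr1 mulf_neq0 ?pnatr_eq0 //.
    by rewrite -lt0n muln_gt0 s_gt0.
  + have -> : 0 = vec 2 [:: 0; 0] :> 'rV[R]_2.
      by apply/rowP => -[[|[|//]] i]; rewrite !mxE.
    by apply: PM; rewrite inE eqxx.
  + move=> i; have -> : row i M =
      vec 2 (nth [::] [:: [:: e.+1%:R; 0]; [:: 1; (s * e)%:R]] i).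
      by apply/rowP => j; rewrite !mxE.
    by apply: PM; case: i => [[|[|//]] i]; rewrite !inE eqxx ?orbT.
- apply: hstar_degree2 => // k; rewrite ehrhart_quad; congr Posz.
  have := sum_quad_height p s k e_gt0; rewrite addn2 /= a1E -a2E; nia.
Qed.

End Quadrilateral.

(** * The three-dimensional polytopes over the unit square *)

Section Tent.
Variables (R : realType) (a r : nat).
Hypothesis (a_gt0 : (0 < a)%N).

Definition tent_vertices : seq 'rV[R]_3 :=
  [:: vec 3 [:: 0; 0; 0]; vec 3 [:: 0; 0; a%:R]; vec 3 [:: 1; 0; 0];
      vec 3 [:: 0; 1; 0]; vec 3 [:: 1; 1; r%:R]].

Definition tent_points k : seq 'rV[R]_3 :=
  [seq vec 3 [:: q.1%:R; q.2%:R; z%:R]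
    | q <- [seq (x, y) | x <- iota 0 k.+1, y <- iota 0 k.+1],
      z <- iota (tent_low r k q) (tent_high a r k q - tent_low r k q).+1].

Lemma tent_low_le_high k x y :
  (x <= k)%N -> (y <= k)%N -> (tent_low r k (x, y) <= tent_high a r k (x, y))%N.
Proof.
move=> xk yk; rewrite /tent_low /tent_high /=.
have low_le : (r * (x + y - k) <= r * minn x y)%N by rewrite leq_mul2l; lia.
by rewrite (leq_trans low_le) // leq_addl.
Qed.

(** Barycentric coordinates in the lower facets, with vertices over (0,0), (1,0),
    (0,1) and over (1,0), (0,1), (1,1). *)
Lemma scaled_comb_tent_low k x y : (x <= k)%N -> (y <= k)%N ->
  scaled_comb tent_vertices k%:R
    (vec 3 [:: x%:R; y%:R; (tent_low r k (x, y))%:R]).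
Proof.
move=> xk yk; rewrite /tent_low /=; have [xyk|xyk] := leqP (x + y) k.
  exists (nth 0 [:: k%:R - (x + y)%:R; 0; x%:R; y%:R; 0]).
  split=> [[|[|[|[|[|i]]]]] //=||].
  - by rewrite subr_ge0 ler_nat.
  - by rewrite nth_nil.
  - by rewrite !big_ord_recl big_ord0 /= natrD; ring.
  - have -> : (x + y - k = 0)%N by lia.
    apply/rowP => j; rewrite summxE !big_ord_recl big_ord0 !mxE muln0.
    by case: j => [[|[|[|//]]] i] /=; ring.
exists (nth 0 [:: 0; 0; k%:R - y%:R; k%:R - x%:R; (x + y)%:R - k%:R]).
split=> [[|[|[|[|[|i]]]]] //=||]; rewrite ?subr_ge0 ?ler_nat ?nth_nil ?(ltnW xyk) //.
- by rewrite !big_ord_recl big_ord0 /= natrD; ring.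
- apply/rowP => j; rewrite summxE !big_ord_recl big_ord0 !mxE.
  rewrite natrM (natrB _ (ltnW xyk)) natrD.
  by case: j => [[|[|[|//]]] i] /=; ring.
Qed.

(** Barycentric coordinates in the upper facets, with vertices over (0,0), (0,1),
    (1,1) and over (0,0), (1,0), (1,1). *)
Lemma scaled_comb_tent_high k x y : (x <= k)%N -> (y <= k)%N ->
  scaled_comb tent_vertices k%:R
    (vec 3 [:: x%:R; y%:R; (tent_high a r k (x, y))%:R]).
Proof.
move=> xk yk; rewrite /tent_high /=; case: leqP => xy.
  exists (nth 0 [:: 0; k%:R - y%:R; 0; y%:R - x%:R; x%:R]).
  split=> [[|[|[|[|[|i]]]]] //=||]; rewrite ?subr_ge0 ?ler_nat ?nth_nil //.
  - by rewrite !big_ord_recl big_ord0 /=; ring.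
  - apply/rowP => j; rewrite summxE !big_ord_recl big_ord0 !mxE.
    rewrite natrD !natrM (natrB _ yk).
    by case: j => [[|[|[|//]]] i] /=; ring.
exists (nth 0 [:: 0; k%:R - x%:R; x%:R - y%:R; 0; y%:R]).
split=> [[|[|[|[|[|i]]]]] //=||]; rewrite ?subr_ge0 ?ler_nat ?nth_nil ?(ltnW xy) //.
- by rewrite !big_ord_recl big_ord0 /=; ring.
- apply/rowP => j; rewrite summxE !big_ord_recl big_ord0 !mxE.
  rewrite natrD !natrM (natrB _ xk).
  by case: j => [[|[|[|//]]] i] /=; ring.
Qed.

(** The four linear functions bounding the segments from below and above are
    bounds on the whole hull, because they are so at its five vertices. *)
Lemma tent_pointsP k :
  dilate k (convex_hull [set` tent_vertices]) `&` @integer_lattice R 3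
  = [set` tent_points k].
Proof.
apply/seteqP; split=> v /=.
  move=> [/dilate_hullP -/(_ isT) [w [w0 sw vw]] v_int].
  pose j1 : 'I_3 := lift ord0 ord0; pose j2 : 'I_3 := lift ord0 (lift ord0 ord0).
  have v0 : v ord0 ord0 = w 2 + w 4.
    by rewrite vw summxE !big_ord_recl big_ord0 !mxE /=; ring.
  have v1 : v ord0 j1 = w 3 + w 4.
    by rewrite vw summxE !big_ord_recl big_ord0 !mxE /=; ring.
  have v2 : v ord0 j2 = a%:R * w 1 + r%:R * w 4.
    by rewrite vw summxE !big_ord_recl big_ord0 !mxE /=; ring.
  move: sw (w0 0) (w0 1) (w0 2) (w0 3) (w0 4).
  rewrite !big_ord_recl big_ord0 /= !addr0.
  move=> {vw} + w0_ge0 w1_ge0 w2_ge0 w3_ge0 w4_ge0.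
  rewrite -/(w 0%N + (w 1%N + (w 2%N + (w 3%N + w 4%N))) = _) => sw.
  have /natrP[x xE] : v ord0 ord0 \is a Num.nat.
    by rewrite natrEint (mxOverP v_int) v0 addr_ge0.
  have /natrP[y yE] : v ord0 j1 \is a Num.nat.
    by rewrite natrEint (mxOverP v_int) v1 addr_ge0.
  have /natrP[z zE] : v ord0 j2 \is a Num.nat.
    by rewrite natrEint (mxOverP v_int) v2 addr_ge0 ?mulr_ge0 ?ler0n.
  rewrite xE in v0; rewrite yE in v1; rewrite zE in v2.
  have xk : (x <= k)%N by rewrite -(ler_nat R) v0 -sw; lra.
  have yk : (y <= k)%N by rewrite -(ler_nat R) v1 -sw; lra.
  have aw i : 0 <= a%:R * w i by rewrite mulr_ge0.
  have rw i : 0 <= r%:R * w i by rewrite mulr_ge0.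
  have low_le : (tent_low r k (x, y) <= z)%N.
    rewrite /tent_low /=; have [xyk|xyk] := leqP (x + y) k.
      have -> : (x + y - k = 0)%N by lia.
      by rewrite muln0.
    rewrite -(ler_nat R) natrM (natrB _ (ltnW xyk)) natrD v0 v1 v2 -sw.
    (* The gap is r (w0 + w1) + a w1. *)
    have := rw 0%N; have := rw 1%N; have := aw 1%N; lra.
  have le_high : (z <= tent_high a r k (x, y))%N.
    rewrite /tent_high /=; case: (leqP x y) => _.
      rewrite -(ler_nat R) natrD !natrM (natrB _ yk) v0 v1 v2 -sw.
      have := aw 0%N; have := aw 2%N; have := rw 2%N; lra.
    rewrite -(ler_nat R) natrD !natrM (natrB _ xk) v0 v1 v2 -sw.
    have := aw 0%N; have := aw 3%N; have := rw 3%N; lra.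
  apply/allpairsPdep; exists (x, y), z; split.
  - by apply/allpairsP; exists (x, y); rewrite !mem_iota !add0n !ltnS.
  - by rewrite mem_iota low_le addnS ltnS subnKC // (leq_trans low_le).
  - apply/rowP => -[[|[|[|//]]] i]; rewrite mxE /=.
    + by rewrite -xE; congr (v _ _); apply: val_inj.
    + by rewrite -yE; congr (v _ _); apply: val_inj.
    + by rewrite -zE; congr (v _ _); apply: val_inj.
move=> /allpairsPdep[q [z [/allpairsP[[x y] [+ + ->]] + ->]]].
rewrite !mem_iota !add0n !ltnS /= => xk yk.
rewrite addnS ltnS subnKC ?tent_low_le_high // => z_range.
split; last exact: (@vec_lattice R 3 [:: x; y; z]).
apply/dilate_hullP => //; apply: (@scaled_comb_between _ _ _ _ [:: x%:R; y%:R]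
  (tent_low r k (x, y))%:R _ (tent_high a r k (x, y))%:R).
- by rewrite !ler_nat.
- exact: scaled_comb_tent_low.
- exact: scaled_comb_tent_high.
Qed.

Lemma uniq_tent_points k : uniq (tent_points k).
Proof.
apply: allpairs_uniq_dep => [|q _|[[x y] z] [[x' y'] z'] _ _ /=].
- by apply: allpairs_uniq => [||[x y] [x' y'] _ _ //]; rewrite iota_uniq.
- by rewrite iota_uniq.
- move=> /rowP eq_v; congr existT; [congr pair|]; apply/eqP;
    rewrite -(eqr_nat R); apply/eqP.
  + by have := eq_v ord0; rewrite !mxE.
  + by have := eq_v (lift ord0 ord0); rewrite !mxE.
  + by have := eq_v (lift ord0 (lift ord0 ord0)); rewrite !mxE.
Qed.

Lemma ehrhart_tent k :
  ehrhart_series (convex_hull [set` tent_vertices]) k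
  = (\sum_(x < k.+1) \sum_(y < k.+1)
      (tent_high a r k (x : nat, y : nat) - tent_low r k (x : nat, y : nat)).+1)%N.
Proof.
rewrite (ehrhart_series_size (uniq_tent_points k) (tent_pointsP k)).
rewrite size_allpairs_dep sumnE big_map big_allpairs; congr Posz.
rewrite -{1}(subn0 k.+1) -/(index_iota _ _) big_mkord; apply: eq_bigr => x _.
rewrite -{1}(subn0 k.+1) -/(index_iota _ _) big_mkord; apply: eq_bigr => y _.
by rewrite size_iota.
Qed.

Lemma tent_polytope (a2 : nat) :
  (a2.+1 = a + r)%N ->
  [/\ is_lattice_polytope (convex_hull [set` tent_vertices]),
      has_dim (convex_hull [set` tent_vertices]) 3
    & is_hstar_polynomial (convex_hull [set` tent_vertices])
        (a2%:Z *: 'X^2 + a%:Z *: 'X + 1)].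
Proof.
move=> a2E; split.
- apply: is_lattice_polytope_hull => v; rewrite !inE.
  by move=> /or4P[||| /orP[]] /eqP->;
    [exact: (@vec_lattice R 3 [:: 0; 0; 0]%N)
    |exact: (@vec_lattice R 3 [:: 0; 0; a]%N)
    |exact: (@vec_lattice R 3 [:: 1; 0; 0]%N)
    |exact: (@vec_lattice R 3 [:: 0; 1; 0]%N)
    |exact: (@vec_lattice R 3 [:: 1; 1; r]%N)].
- pose rows : seq (seq R) := [:: [:: 1; 0; 0]; [:: 0; 1; 0]; [:: 0; 0; a%:R]].
  have PM v : v \in tent_vertices -> convex_hull [set` tent_vertices] v.
    exact: sub_convex_hull.
  apply: (@has_dim_full _ _ _ (\matrix_(i, j) (nth [::] rows i)`_j)).
  + rewrite det_trig; last first.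
      by apply/is_trig_mxP => -[[|[|[|//]]] i] [[|[|[|//]]] j] //; rewrite mxE.
    by rewrite !big_ord_recl big_ord0 !mxE /= !mul1r mulr1 pnatr_eq0 -lt0n.
  + have -> : 0 = vec 3 [:: 0; 0; 0] :> 'rV[R]_3.
      by apply/rowP => -[[|[|[|//]]] i]; rewrite !mxE.
    by apply: PM; rewrite inE eqxx.
  + move=> i; have -> : row i (\matrix_(i, j) (nth [::] rows i)`_j) =
      vec 3 (nth [::] rows i) by apply/rowP => j; rewrite !mxE.
    by apply: PM; case: i => [[|[|[|//]]] i]; rewrite !inE eqxx ?orbT.
- apply: hstar_degree2 => // k; rewrite ehrhart_tent; congr Posz.
  have := sum_tent a r k; rewrite -a2E addn3 /=; lia.
Qed.

End Tent.

(** * All admissible pairs of coefficients *)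

Theorem proposition1p10 (R : realType) (a1 a2 : nat)
    (a1_gt0 : (0 < a1)%N) (a2_gt0 : (0 < a2)%N)
    (a1_le7 : a2 = 1%N -> (a1 <= 7)%N)
    (a1_le : (2 <= a2)%N -> (a1 <= 3 * a2 + 3)%N) :
  exists (d : nat) (P : set 'rV[R]_d),
    [/\ (0 < d)%N, is_lattice_polytope P, has_dim P d
      & is_hstar_polynomial P (a2%:Z *: 'X^2 + a1%:Z *: 'X + 1)].
Proof.
have [a1_le_a2|a2_lt_a1] := leqP a1 a2.
  have [|P_lat P_dim P_h] := @tent_polytope R a1 (a2.+1 - a1) a1_gt0 a2; first lia.
  by exists 3%N, (convex_hull [set` tent_vertices R a1 (a2.+1 - a1)]).
have [a1_le_3a2|a1_gt] := leqP a1 (3 * a2 + 3).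
  have [||||| P_lat P_dim P_h] := @quad_polytope R (a1 - a2.+1) a2.+1 1 _ _ a1 a2.
  all: rewrite ?binn; try lia.
  by exists 2%N, (convex_hull [set` quad_vertices R (a1 - a2.+1) a2.+1 1]).
(* Beyond 3 a2 + 3 only a1 = 7, a2 = 1 is left. *)
have [-> ->] : a1 = 7 /\ a2 = 1%N.
  by case: (a2) a2_gt0 a1_le7 a1_le a1_gt => [|[|]] //; lia.
have [|||||P_lat P_dim P_h] := @quad_polytope R 3 1 2 _ _ 7 1; rewrite //.
by exists 2%N, (convex_hull [set` quad_vertices R 3 1 2]).
Qed.
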